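(* Every profinite group of finite semisimple length is profinitely rigid.
   Context: A profinite group is semisimple if it is (topologically isomorphic to) a Cartesian product of finite nonabelian simple groups. A profinite group $G$ has finite semisimple length if there is a finite series $1=G_n\trianglelefteq\cdots\trianglelefteq G_1\trianglelefteq G_0=G$ of closed subgroups with every quotient $G_i/G_{i+1}$ semisimple. A profinite group $G$ is profinitely rigid if its underlying abstract group admits exactly one topology making it a profinite group. *)

(* Defs.v *)
From Stdlib Require Import List.
From mathcomp Require Import all_boot all_fingroup all_solvable.
Set Implicit Arguments. Unset Strict Implicit. Unset Printing Implicit Defensive.

Record group_law (T : Type) := GroupLaw {
  gmul : T -> T -> T; ginv : T -> T; gone : T }.

Definition is_group (T : Type) (G : group_law T) : Prop :=
  (forall x y z, gmul G x (gmul G y z) = gmul G (gmul G x y) z) /\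
  (forall x, gmul G (gone G) x = x) /\
  (forall x, gmul G (ginv G x) x = gone G).

Definition is_subgroup (T : Type) (G : group_law T) (H : T -> Prop) : Prop :=
  H (gone G) /\ (forall x y, H x -> H y -> H (gmul G x y)) /\
  (forall x, H x -> H (ginv G x)).

Definition is_normal_in (T : Type) (G : group_law T) (N H : T -> Prop) : Prop :=
  is_subgroup G N /\ (forall x, N x -> H x) /\
  (forall x h, N x -> H h -> N (gmul G (ginv G h) (gmul G x h))).

Definition topology (T : Type) := (T -> Prop) -> Prop.

Definition is_topology (T : Type) (O : topology T) : Prop :=
  O (fun _ => True) /\
  (forall U V, O U -> O V -> O (fun x => U x /\ V x)) /\
  (forall F : (T -> Prop) -> Prop, (forall U, F U -> O U) ->
     O (fun x => exists U, F U /\ U x)).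

Definition is_closed (T : Type) (O : topology T) (C : T -> Prop) : Prop :=
  O (fun x => ~ C x).

Definition compact_space (T : Type) (O : topology T) : Prop :=
  forall F : (T -> Prop) -> Prop, (forall U, F U -> O U) ->
    (forall x, exists U, F U /\ U x) ->
    exists l : seq (T -> Prop), (forall U, List.In U l -> F U) /\
      (forall x, exists U, List.In U l /\ U x).

Definition hausdorff (T : Type) (O : topology T) : Prop :=
  forall x y, x <> y -> exists U V, O U /\ O V /\ U x /\ V y /\
    (forall z, U z -> V z -> False).

Definition connected_subset (T : Type) (O : topology T) (C : T -> Prop) : Prop :=
  ~ (exists U V, O U /\ O V /\ (forall x, C x -> U x \/ V x) /\
       (exists x, C x /\ U x) /\ (exists x, C x /\ V x) /\
       (forall x, C x -> U x -> V x -> False)).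

Definition totally_disconnected (T : Type) (O : topology T) : Prop :=
  forall C, connected_subset O C -> forall x y, C x -> C y -> x = y.

Definition is_topological_group (T : Type) (G : group_law T) (O : topology T)
  : Prop :=
  is_group G /\ is_topology O /\
  (forall x y W, O W -> W (gmul G x y) ->
     exists U V, O U /\ O V /\ U x /\ V y /\
       (forall u v, U u -> V v -> W (gmul G u v))) /\
  (forall W, O W -> O (fun x => W (ginv G x))).

Definition profinite (T : Type) (G : group_law T) (O : topology T) : Prop :=
  is_topological_group G O /\ compact_space O /\ hausdorff O /\
  totally_disconnected O.

(* Cartesian products of finite groups, with the product topology of   *)
(* the discrete topologies                                             *)
Definition prod_open (I : Type) (S : I -> finGroupType)
  (V : (forall i, S i) -> Prop) : Prop :=
  forall x, V x -> exists J : seq I,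
    forall y : (forall i, S i), (forall j, List.In j J -> y j = x j) -> V y.

Definition prod_mul (I : Type) (S : I -> finGroupType)
  (x y : forall i, S i) : forall i, S i := fun i => (x i * y i)%g.
Definition prod_one (I : Type) (S : I -> finGroupType) : forall i, S i :=
  fun i => 1%g.

(* f : T -> prod S, restricted to the subgroup H (with the subspace
   topology), is a continuous open surjective homomorphism with kernel N;
   i.e. f induces a topological isomorphism H/N ~ prod S. *)
Definition quotient_iso_to_prod (T : Type) (G : group_law T) (O : topology T)
  (H N : T -> Prop) (I : Type) (S : I -> finGroupType)
  (f : T -> forall i, S i) : Prop :=
  (forall x y, H x -> H y -> f (gmul G x y) = prod_mul (f x) (f y)) /\
  (forall V, prod_open V -> exists U, O U /\
     (forall x, H x -> (V (f x) <-> U x))) /\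
  (forall U, O U -> prod_open (fun p => exists x, H x /\ U x /\ f x = p)) /\
  (forall p, exists x, H x /\ f x = p) /\
  (forall x, N x <-> (H x /\ f x = prod_one S)).

Definition semisimple_quotient (T : Type) (G : group_law T) (O : topology T)
  (H N : T -> Prop) : Prop :=
  exists (I : Type) (S : I -> finGroupType),
    (forall i, simple [set: S i] /\ ~~ abelian [set: S i]) /\
    exists f : T -> forall i, S i, quotient_iso_to_prod G O H N f.

Definition finite_semisimple_length (T : Type) (G : group_law T)
  (O : topology T) : Prop :=
  exists (n : nat) (Gs : nat -> T -> Prop),
    (forall x, Gs 0 x) /\
    (forall x, Gs n x <-> x = gone G) /\
    (forall i, i <= n -> is_subgroup G (Gs i) /\ is_closed O (Gs i)) /\
    (forall i, i < n -> is_normal_in G (Gs i.+1) (Gs i) /\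
                        semisimple_quotient G O (Gs i) (Gs i.+1)).

Definition profinitely_rigid (T : Type) (G : group_law T) : Prop :=
  exists O : topology T, profinite G O /\
    forall O' : topology T, profinite G O' -> O' = O.

(* Main.v *)
Require Import Defs.
From mathcomp Require Import all_boot all_fingroup all_solvable.
From mathcomp Require Import boolp.

Set Implicit Arguments. Unset Strict Implicit. Unset Printing Implicit Defensive.

(* Let O and O' be two profinite topologies on G.  Call g in H <= G adherent to
   1 if every O-neighbourhood of g meets every O'-neighbourhood of 1 inside H;
   by compactness it suffices that only 1 is adherent to 1 in G.  This is shown
   by induction on the length of a semisimple series of H, where the quotients
   may be weakened to groups lying between a direct sum and a product of finite
   nonabelian simple groups.  Let M be the last nontrivial term.  A simple
   factor S of M is subnormal in H, so every open normal subgroup meeting S trivially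
   centralises S by the three subgroups lemma; hence an element g adherent to 1
   lies in the centraliser C of all H-conjugates of the factors of M.  As C is
   normal in H and meets M trivially, it has a shorter series.  For x in C the
   commutator [x, g] is adherent to 1 in C, so it is trivial by induction, and
   g is in the centre of C, which is trivial. *)

(** * Finite simple groups as induction principles *)

Section SimpleGroups.
Variable gT : finGroupType.
Implicit Type P : gT -> Prop.

(** By finiteness, closure under products makes [P] a subgroup; closure under conjugation makes it
    normal and the witness makes it nontrivial, so simplicity leaves only the whole group. *)
Lemma simple_normal_ind P :
    simple [set: gT] -> P 1%g ->
    (forall x y, P x -> P y -> P (x * y)%g) ->
    (forall x y, P x -> P (x ^ y)%g) ->
    (exists2 x, P x & x != 1%g) ->
  forall x, P x.
Proof.
move=> /simpleP[_ simT] P1 PM PJ [y Py y1] x.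
pose A := [set x | `[< P x >]].
have gA : group_set A.
  apply/group_setP; split; first by rewrite inE; apply/asboolP.
  by move=> a b; rewrite !inE => /asboolP Pa /asboolP Pb; apply/asboolP/PM.
have nA : (Group gA <| [set: gT])%g.
  rewrite /normal subsetT; apply/subsetP => a _; rewrite inE.
  apply/subsetP => _ /imsetP[b + ->]; rewrite !inE => /asboolP Pb.
  by apply/asboolP/PJ.
have [/= A1|/= AT] := simT _ nA.
  have : y \in A by rewrite inE; apply/asboolP.
  by rewrite A1 inE (negPf y1).
have : x \in A by rewrite AT inE.
by rewrite inE => /asboolP.
Qed.

(** [P] defines a subgroup containing all commutators, and the derived subgroup of a nonabelian
    simple group is the whole group. *)
Lemma simple_commutator_ind P :
    simple [set: gT] -> ~~ abelian [set: gT] -> P 1%g ->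
    (forall x y, P x -> P y -> P (x * y)%g) ->
    (forall x y, P [~ x, y]%g) ->
  forall x, P x.
Proof.
move=> /simpleP[_ simT] nabT P1 PM PR x.
pose A := [set x | `[< P x >]].
have gA : group_set A.
  apply/group_setP; split; first by rewrite inE; apply/asboolP.
  by move=> a b; rewrite !inE => /asboolP Pa /asboolP Pb; apply/asboolP/PM.
have sRA : ([~: [set: gT], [set: gT]] \subset Group gA)%g.
  rewrite gen_subG; apply/subsetP => _ /imset2P[a b _ _ ->].
  by rewrite inE; apply/asboolP.
have [R1|/= RT] := simT [~: [set: gT], [set: gT]]%G (der_normal 1 _).
  by case/negP: nabT; apply/commG1P.
have : x \in A by apply: (subsetP sRA); rewrite RT inE.
by rewrite inE => /asboolP.
Qed.

Lemma simple_center_trivial (c : gT) :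
    simple [set: gT] -> ~~ abelian [set: gT] ->
  (forall x, commute c x) -> c = 1%g.
Proof.
move=> simT nabT cc; apply/eqP/negPn/negP => c1; case/negP: nabT.
pose P x := forall y : gT, commute x y.
suff cT x : P x by apply/centsP => x _ y _; apply: cT.
apply: (simple_normal_ind (P := P)) x => //.
- by move=> y; apply/commute_sym/commute1.
- by move=> a b ca cb y; apply/commute_sym/commuteM; apply/commute_sym.
- by move=> a b ca y; rewrite conjgE (ca b) mulKg; apply: ca.
- by exists c.
Qed.

End SimpleGroups.

(** * Elementary calculus in an abstract group *)

Section GroupLaws.
Variables (T : Type) (G : group_law T).
Hypothesis isG : is_group G.

Local Notation "x ** y" := (gmul G x y) (at level 40, left associativity).
Local Notation inv := (ginv G).
Local Notation e := (gone G).

Lemma law_mulA x y z : x ** y ** z = x ** (y ** z).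
Proof. by case: isG. Qed.

Lemma law_mul1 x : e ** x = x.
Proof. by case: isG => _ []. Qed.

Lemma law_mulV x : inv x ** x = e.
Proof. by case: isG => _ []. Qed.

Lemma law_mulVK x y : inv x ** (x ** y) = y.
Proof. by rewrite -law_mulA law_mulV law_mul1. Qed.

Lemma law_mulI x y z : x ** y = x ** z -> y = z.
Proof. by move=> E; rewrite -(law_mulVK x y) E law_mulVK. Qed.

Lemma law_mulr1 x : x ** e = x.
Proof. by apply: (@law_mulI (inv x)); rewrite law_mulVK law_mulV. Qed.

Lemma law_mulrV x : x ** inv x = e.
Proof. by apply: (@law_mulI (inv x)); rewrite law_mulVK law_mulr1. Qed.

Lemma law_mulKV x y : x ** (inv x ** y) = y.
Proof. by rewrite -law_mulA law_mulrV law_mul1. Qed.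

Lemma law_invK x : inv (inv x) = x.
Proof. by apply: (@law_mulI (inv x)); rewrite law_mulV law_mulrV. Qed.

Lemma law_inv1 : inv e = e.
Proof. by apply: (@law_mulI e); rewrite law_mulrV law_mul1. Qed.

Lemma law_invM x y : inv (x ** y) = inv y ** inv x.
Proof.
apply: (@law_mulI (x ** y)).
by rewrite law_mulrV law_mulA law_mulKV law_mulrV.
Qed.

Definition lawE := (law_mulA, law_mul1, law_mulr1, law_mulV, law_mulrV,
  law_mulVK, law_mulKV, law_invK, law_inv1, law_invM).

Lemma law_mulVeq1 x y : inv x ** y = e -> x = y.
Proof. by move=> E; apply: (@law_mulI (inv x)); rewrite law_mulV. Qed.

Lemma subgroup1 H : is_subgroup G H -> H e. Proof. by case. Qed.

Lemma subgroupM H x y : is_subgroup G H -> H x -> H y -> H (x ** y).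
Proof. by move=> [_ [HM _]]; apply: HM. Qed.

Lemma subgroupV H x : is_subgroup G H -> H x -> H (inv x).
Proof. by move=> [_ [_ HV]]; apply: HV. Qed.

Lemma subgroupVr H x : is_subgroup G H -> H (inv x) -> H x.
Proof. by move=> sH /(subgroupV sH); rewrite law_invK. Qed.

(** * Commutators, perfect subgroups and the three subgroups lemma *)

Definition law_commute x y := x ** y = y ** x.
Definition law_commutator x y := inv x ** (inv y ** (x ** y)).

Lemma law_commuteP x y : law_commutator x y = e <-> law_commute x y.
Proof.
rewrite /law_commutator /law_commute; split=> [E|->]; last by rewrite !lawE.
apply: (@law_mulI (inv y)); apply: (@law_mulI (inv x)).
by rewrite E !lawE.
Qed.

Lemma law_commute_sym x y : law_commute x y -> law_commute y x.
Proof. by []. Qed.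

Lemma law_commuteV x y : law_commute x y -> law_commute (inv x) y.
Proof.
move=> E; apply: (@law_mulI x); rewrite law_mulKV -law_mulA E.
by rewrite !lawE.
Qed.

Lemma law_commuteM x y z :
  law_commute x z -> law_commute y z -> law_commute (x ** y) z.
Proof. by move=> xz yz; rewrite /law_commute law_mulA yz -law_mulA xz law_mulA. Qed.

Lemma law_commuteJ x y z :
  law_commute (z ** x ** inv z) y -> law_commute x (inv z ** y ** z).
Proof.
rewrite /law_commute => E.
apply: (@law_mulI z); rewrite !lawE -[RHS]law_mulr1 -(law_mulV z).
rewrite -[X in _ = X]law_mulA.
have -> : y ** (z ** x) ** inv z = z ** x ** inv z ** y by rewrite E !lawE.
by rewrite !lawE.
Qed.

Lemma law_conj_commute a t z :
  law_commute a t -> inv a ** (inv t ** (a ** z)) = inv t ** z.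
Proof.
move=> E; apply: (@law_mulI t); apply: (@law_mulI a).
by rewrite -[LHS]law_mulA E !lawE.
Qed.

(** For a subgroup [X] this says [X = [X, X]], phrased as an induction principle. Closure under
    products suffices because the inverse of a commutator is again one. *)
Definition law_perfect (X : T -> Prop) := forall P : T -> Prop,
  P e -> (forall x y, X x -> X y -> P x -> P y -> P (x ** y)) ->
  (forall x y, X x -> X y -> P (law_commutator x y)) ->
  forall x, X x -> P x.

(* Writing s^u = a s and t^u = b t, both a and b centralise X, and a
   centralises X^u as well, so that [s^u, t^u] collapses to [s, t]. *)
Lemma three_subgroups (X D : T -> Prop) :
    law_perfect X -> (forall u, D u -> D (inv u)) ->
    (forall u s t, D u -> X s -> X t ->
       law_commute (inv u ** s ** u ** inv s) t) ->
  forall u x, D u -> X x -> law_commute u x.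
Proof.
move=> pX DV cDX u x Du; move: x.
apply: pX => [|x y _ _ ux uy|s t Xs Xt]; first by rewrite /law_commute !lawE.
  exact/law_commute_sym/law_commuteM.
have [s' s'E] : exists s', s' = inv u ** s ** u by exists (inv u ** s ** u).
have [t' t'E] : exists t', t' = inv u ** t ** u by exists (inv u ** t ** u).
have [a aE] : exists a, a = s' ** inv s by exists (s' ** inv s).
have [b bE] : exists b, b = t' ** inv t by exists (t' ** inv t).
have sE : s' = a ** s by rewrite aE !lawE.
have tE : t' = b ** t by rewrite bE !lawE.
(* The conjugate [u ** a ** inv u] is the inverse of an element covered by [cDX], taken for [inv u]
   and [s]; here closure of [D] under inverses enters. *)
have at' : law_commute a t'.
  rewrite t'E; apply: law_commuteJ.
  have -> : u ** a ** inv u = inv (inv (inv u) ** s ** inv u ** inv s).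
    by rewrite aE s'E !lawE.
  exact/law_commuteV/cDX/Xt/Xs/DV.
have bs : law_commute b s by rewrite bE t'E; apply: cDX.
have : inv u ** law_commutator s t ** u = law_commutator s t.
  transitivity (law_commutator s' t').
    by rewrite /law_commutator s'E t'E !lawE.
  rewrite /law_commutator sE law_invM !law_mulA.
  rewrite (law_conj_commute _ at') tE law_invM !law_mulA.
  by rewrite -[X in inv b ** X](law_mulA s) -bs law_mulA law_mulVK.
by move=> E; rewrite /law_commute -{1}E !lawE.
Qed.

(** * Quotients between a direct sum and a product of simple groups *)

Definition supported_at (I : Type) (S : I -> finGroupType) (i : I)
  (p : forall j, S j) := forall j, j <> i -> p j = 1%g.

(* The quotient H/N lies between the direct sum and the product of the S i.
   Unlike [quotient_iso_to_prod], this passes to normal subgroups of H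
   without any closedness assumption. *)
Definition sum_quotient_map (H N : T -> Prop) (I : Type)
    (S : I -> finGroupType) (f : T -> forall i, S i) :=
  [/\ forall i, simple [set: S i] /\ ~~ abelian [set: S i],
      forall x y i, H x -> H y -> f (x ** y) i = (f x i * f y i)%g,
      forall i s, exists x, [/\ H x, f x i = s & supported_at i (f x)]
    & forall x, N x <-> (H x /\ forall i, f x i = 1%g)].

Definition sum_quotient (H N : T -> Prop) :=
  exists (I : Type) (S : I -> finGroupType) (f : T -> forall i, S i),
    sum_quotient_map H N f.

(** The topological conditions of a semisimple series are dropped, so that a series can be
    intersected with a centraliser. *)
Definition sum_series (n : nat) (Hs : nat -> T -> Prop) :=
  [/\ is_subgroup G (Hs 0), forall x, Hs n x <-> x = e,
      forall i, i < n -> is_normal_in G (Hs i.+1) (Hs i)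
    & forall i, i < n -> sum_quotient (Hs i) (Hs i.+1)].

Lemma sum_quotient_of_semisimple O H N :
  semisimple_quotient G O H N -> sum_quotient H N.
Proof.
move=> [I [S [simS [f [fM [_ [_ [fsurj fker]]]]]]]]; exists I, S, f; split=> //.
- by move=> x y i Hx Hy; rewrite fM.
- move=> i s.
  (* The family with value [s] at [i] and 1 elsewhere; [s] is transported to [S j] along the
     equality of indices. *)
  pose d j : S j := match pselect (i = j) with
    | left E => eq_rect i (fun k => S k) s j E | right _ => 1%g end.
  have [x [Hx fx]] := fsurj d; exists x; split=> //; rewrite fx /d.
    by case: pselect => // E; rewrite (Prop_irrelevance E erefl).
  by move=> j ji; case: pselect => // E; case: ji.
- move=> x; rewrite fker; split=> -[Hx fx]; split=> //; first by rewrite fx.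
  exact: functional_extensionality_dep.
Qed.

Section SumQuotient.
Variables (H N : T -> Prop) (I : Type) (S : I -> finGroupType).
Variable f : T -> forall i, S i.
Hypotheses (sH : is_subgroup G H) (fP : sum_quotient_map H N f).

Let fM x y i : H x -> H y -> f (x ** y) i = (f x i * f y i)%g.
Proof. by case: fP => _ + _ _; apply. Qed.

Lemma sum_quotient_map1 i : f e i = 1%g.
Proof.
have He := subgroup1 sH; apply: (mulgI (f e i)).
by rewrite -fM // law_mul1 mulg1.
Qed.

Lemma sum_quotient_mapV x i : H x -> f (inv x) i = (f x i)^-1%g.
Proof.
move=> Hx; apply: (mulgI (f x i)).
by rewrite -fM ?law_mulrV ?sum_quotient_map1 ?mulgV //; apply: subgroupV.
Qed.

Lemma sum_quotient_map_commutator x y i : H x -> H y ->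
  f (law_commutator x y) i = [~ f x i, f y i]%g.
Proof.
move=> Hx Hy; have [HVx HVy] := (subgroupV sH Hx, subgroupV sH Hy).
have Hxy := subgroupM sH Hx Hy.
by rewrite /law_commutator !fM ?sum_quotient_mapV //; apply: subgroupM.
Qed.

Lemma sum_quotient_map_conj x y i : H x -> H y ->
  f (inv y ** (x ** y)) i = (f x i ^ f y i)%g.
Proof.
move=> Hx Hy; have HVy := subgroupV sH Hy.
by rewrite !fM ?sum_quotient_mapV //; apply: subgroupM.
Qed.

(** Elements supported at [i] realise every value in [S i], so each coordinate of [f c] is central
    in a nonabelian simple group. *)
Lemma sum_quotient_centre c :
  H c -> (forall i x, H x -> supported_at i (f x) -> law_commute c x) -> N c.
Proof.
case: fP => simS _ fsurj fker Hc cc; apply/fker; split=> // i.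
have [simSi nabSi] := simS i; apply: simple_center_trivial => // s.
have [x [Hx <- fx]] := fsurj i s.
by rewrite /commute -!fM // (cc i).
Qed.

(** The full preimage in [H] of the [i]-th simple factor; it contains [N], and is a copy of [S i]
    once [N] is trivial. *)
Definition factor (i : I) (x : T) := H x /\ supported_at i (f x).

Lemma factor_subgroup i : is_subgroup G (factor i).
Proof.
split; first by split=> [|j _]; [case: sH | apply: sum_quotient_map1].
split=> [x y [Hx fx] [Hy fy]|x [Hx fx]].
  split=> [|j ji]; first exact: subgroupM.
  by rewrite fM // fx // fy // mulg1.
split=> [|j ji]; first exact: subgroupV.
by rewrite sum_quotient_mapV // fx // invg1.
Qed.

Lemma factor_conj i x h : factor i x -> H h -> factor i (inv h ** (x ** h)).
Proof.
move=> [Hx fx] Hh; have HVh := subgroupV sH Hh.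
split=> [|j ji]; first by do 2?apply: subgroupM.
by rewrite sum_quotient_map_conj // fx // conj1g.
Qed.

(** Only the coordinates where [K] is nontrivial are kept. There, commutators of [K] with elements
    supported at [i] stay in [K], and by simplicity their conjugates and products fill [S i]. *)
Lemma sum_quotient_normal K : is_normal_in G K H ->
  sum_quotient K (fun x => K x /\ N x).
Proof.
move=> [sK [KH nKH]]; case: (fP) => simS _ fsurj fker.
pose J i := exists2 k, K k & f k i <> 1%g.
exists {i | J i}, (fun i => S (sval i)), (fun x i => f x (sval i)).
split=> [i|x y i Kx Ky|[i Ji] /= s|x].
- exact: simS.
- by rewrite fM //; apply: KH.
- suff: exists x, [/\ K x, f x i = s & supported_at i (f x)].
    move=> [x [Kx fxi fx]]; exists x; split=> // -[j Jj] ji /=; apply: fx => E.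
    by apply: ji; subst j; rewrite (Prop_irrelevance Ji Jj).
  have [simSi nabSi] := simS i.
  move: s; apply: simple_normal_ind => // [|s t|s t|].
  + exists e; split; [exact: subgroup1 | exact: sum_quotient_map1 |].
    by move=> j _; apply: sum_quotient_map1.
  + move=> [x [Kx <- fx]] [y [Ky <- fy]]; exists (x ** y).
    have [Hx Hy] := (KH _ Kx, KH _ Ky).
    split; [exact: subgroupM | exact: fM |].
    by move=> j ji; rewrite fM // fx // fy // mulg1.
  + move=> [x [Kx <- fx]]; have [y [Hy <- fy]] := fsurj i t.
    have Hx := KH _ Kx; exists (inv y ** (x ** y)).
    split; [exact: nKH | exact: sum_quotient_map_conj |].
    by move=> j ji; rewrite sum_quotient_map_conj // fx // conj1g.
  + have [k Kk fk] := Ji; have Hk := KH _ Kk.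
    (* Since [S i] has trivial centre, some [s] fails to commute with [f k i]. Lifting [s] to [y]
       supported at [i] makes the commutator of [k] and [y] nontrivial and supported at [i]. *)
    have [s ks] : exists s, ~ commute (f k i) s.
      apply/not_existsP => ck; apply: fk.
      by apply: simple_center_trivial => // s; apply: contrapT; apply: ck.
    have [y [Hy fyi fy]] := fsurj i s.
    exists [~ f k i, s]%g; last by apply/commgP.
    exists (law_commutator k y); split.
    * by apply: subgroupM => //; [exact: subgroupV | apply: nKH].
    * by rewrite sum_quotient_map_commutator // fyi.
    * by move=> j ji; rewrite sum_quotient_map_commutator // fy // commg1.
- rewrite fker; split=> [[Kx [Hx fx]]|[Kx fx]]; split=> //.
  split=> [|i]; first exact: KH.
  (* A coordinate where [f x] is nontrivial belongs to [J], with [x] itself as witness, and was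
     therefore assumed trivial. *)
  apply: contrapT => fxi.
  exact: (fxi (fx (exist _ i (ex_intro2 _ _ x Kx fxi)))).
Qed.

Hypothesis N1 : forall x, N x <-> x = e.

Lemma factor_inj i x y : factor i x -> factor i y -> f x i = f y i -> x = y.
Proof.
case: fP => _ _ _ fker [Hx fx] [Hy fy] fxy; apply: law_mulVeq1; apply/N1/fker.
have HVx := subgroupV sH Hx; split=> [|j]; first exact: subgroupM.
rewrite fM // sum_quotient_mapV //; have [->|ji] := pselect (j = i).
  by rewrite fxy mulVg.
by rewrite fx // fy // mulg1 invg1.
Qed.

(** The [i]-th coordinate identifies the factor with [S i], so [simple_commutator_ind] carries
    over. *)
Lemma factor_perfect i : law_perfect (factor i).
Proof.
case: fP => simS _ fsurj fker P P1 PM PR x.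
have sF := factor_subgroup i.
suff: forall s x, factor i x -> f x i = s -> P x by move=> Ps Fx; apply: Ps Fx _.
have [simSi nabSi] := simS i.
apply: simple_commutator_ind => // [y Fy fy|s t Ps Pt y Fy fy|s t y Fy fy].
- have -> // : y = e; apply: factor_inj Fy (subgroup1 sF) _.
  by rewrite fy sum_quotient_map1.
- have [[a [Ha fai fa]] [b [Hb fbi fb]]] := (fsurj i s, fsurj i t).
  have [Fa Fb] : factor i a /\ factor i b by [].
  have -> : y = a ** b.
    apply: factor_inj Fy (subgroupM sF Fa Fb) _.
    by rewrite fy fM // fai fbi.
  by apply: PM => //; [apply: Ps | apply: Pt].
- have [[a [Ha fai fa]] [b [Hb fbi fb]]] := (fsurj i s, fsurj i t).
  have [Fa Fb] : factor i a /\ factor i b by [].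
  have -> : y = law_commutator a b; last exact: PR.
  apply: factor_inj Fy _ _; last first.
    by rewrite fy sum_quotient_map_commutator // fai fbi.
  by do 3?apply: subgroupM => //; apply: subgroupV.
Qed.

(** The values at [i] on the intersection of the factor with [U] form a normal subgroup of [S i].
    Were it nontrivial, it would be everything, and by injectivity [U] would contain [y]. *)
Lemma factor_meet_normal i U : is_normal_in G U (fun _ => True) ->
  (exists2 x, factor i x & ~ U x) -> forall x, factor i x -> U x -> x = e.
Proof.
case: fP => simS _ fsurj _ [sU [_ nU]] [y Fy nUy] x Fx Ux.
have sF := factor_subgroup i.
apply: contrapT => x1; apply: nUy; have [simSi nabSi] := simS i.
suff: exists z, [/\ factor i z, U z & f z i = f y i].
  by move=> [z [Fz Uz fz]]; rewrite -(factor_inj Fz Fy).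
move: (f y i); apply: simple_normal_ind => // [|s t|s t|].
- by exists e; split; [exact: subgroup1 | exact: subgroup1 |
    exact: sum_quotient_map1].
- move=> [a [Fa Ua <-]] [b [Fb Ub <-]]; exists (a ** b).
  have [[Ha _] [Hb _]] := (Fa, Fb).
  by split; [exact: subgroupM | exact: subgroupM | exact: fM].
- move=> [a [Fa Ua <-]]; have [b [Hb <- fb]] := fsurj i t.
  exists (inv b ** (a ** b)); have [Ha _] := Fa.
  by split; [exact: factor_conj | exact: nU | exact: sum_quotient_map_conj].
- exists (f x i); first by exists x.
  apply/eqP => fx; apply: x1; apply: factor_inj Fx (subgroup1 sF) _.
  by rewrite fx sum_quotient_map1.
Qed.

End SumQuotient.

(** * Subnormal series *)

Section Series.
Variables (n : nat) (Hs : nat -> T -> Prop).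
Hypotheses (sHs0 : is_subgroup G (Hs 0))
  (nHs : forall i, i < n -> is_normal_in G (Hs i.+1) (Hs i)).

Lemma series_subgroup i : i <= n -> is_subgroup G (Hs i).
Proof. by case: i => [//|i] /nHs[]. Qed.

Lemma series_sub i j x : i <= j -> j <= n -> Hs j x -> Hs i x.
Proof.
elim: j => [|j IHj]; first by rewrite leqn0 => /eqP->.
rewrite leq_eqVlt => /predU1P[->//|/IHj{}IHj lt_jn Hx].
by apply: IHj (ltnW lt_jn) _; have [_ [+ _]] := nHs lt_jn; apply.
Qed.

(** Ascending from [Hs n] to [Hs 0], the part of each term inside [U] is shown to centralise [X]. At
    the bottom, commutators lie in both [X] and [U]; higher up, [[v, s^-1]] lies in [U] and in the
    next smaller term, so the three subgroups lemma applies. *)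
Lemma subnormal_commute X U :
    (forall x, X x -> Hs n x) -> law_perfect X -> is_subgroup G X ->
    (forall x h, X x -> Hs n h -> X (inv h ** (x ** h))) ->
    is_normal_in G U (fun _ => True) ->
    (forall x, X x -> U x -> x = e) ->
  forall u x, Hs 0 u -> U u -> X x -> law_commute u x.
Proof.
move=> XH pX sX nX [sU [_ nU]] XU.
have UR u s : U u -> U (inv u ** s ** u ** inv s).
  move=> Uu; have := nU u (inv s) Uu Logic.I; rewrite !lawE.
  by apply: subgroupM => //; apply: subgroupV.
(* [k] is the distance from [j] to the last index, so induction on [k] ascends the series. *)
suff main k j : k + j = n ->
    forall u x, Hs j u /\ U u -> X x -> law_commute u x.
  by move=> u x Hu Uu; apply: (main n 0 (addn0 n) u x (conj Hu Uu)).
elim: k j => [|k IHk] j; first rewrite add0n => -> u x [Hu Uu] Xx.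
  apply/law_commuteP/XU.
    have := subgroupM sX (nX _ _ (subgroupV sX Xx) Hu) Xx.
    by rewrite /law_commutator !lawE.
  by have := UR u (inv x) Uu; rewrite /law_commutator !lawE.
rewrite addSn -addnS => jn; have lt_jn : j < n by rewrite -jn leq_addl.
have [_ [HsS nHsj]] := nHs lt_jn.
have [sHj sHj1] := (series_subgroup (ltnW lt_jn), series_subgroup lt_jn).
apply: three_subgroups => // [v [Hv Uv]|v s t [Hv Uv] Xs Xt].
  by split; apply: subgroupV.
apply: IHk jn _ _ _ Xt; split; last exact: UR.
have Hs1 : Hs j.+1 s by apply: series_sub (XH _ Xs).
by rewrite (law_mulA (inv v)); apply: subgroupM (nHsj _ _ Hs1 Hv) (subgroupV _ Hs1).
Qed.


(** A central element slides down the series: its image in each successive quotient is central,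
    hence trivial. *)
Lemma series_centre : (forall x, Hs n x <-> x = e) ->
    (forall i, i < n -> sum_quotient (Hs i) (Hs i.+1)) ->
  forall c, Hs 0 c -> (forall x, Hs 0 x -> law_commute c x) -> c = e.
Proof.
move=> Hsn qHs c Hc cc; apply/Hsn.
suff: forall i, i <= n -> Hs i c by apply.
elim=> // i IHi lt_in; have [I [S [f fP]]] := qHs _ lt_in.
apply: (sum_quotient_centre fP) => [|j x Hx _]; first exact/IHi/ltnW.
by apply: cc; apply: series_sub (ltnW lt_in) Hx.
Qed.

(** Every term is intersected with [C], and [sum_quotient_normal] handles the quotients. The series
    already ends at [n] because [C] meets [Hs n] trivially. *)
Lemma series_normal C : is_normal_in G C (Hs 0) ->
    (forall i, i < n -> sum_quotient (Hs i) (Hs i.+1)) ->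
    (forall x, C x -> Hs n x -> x = e) ->
  sum_series n (fun i x => C x /\ Hs i x).
Proof.
move=> [sC [CH nC]] qHs CHn.
have sCH i : i <= n -> is_subgroup G (fun x => C x /\ Hs i x).
  move=> le_in; have sHi := series_subgroup le_in.
  split; first by split; apply: subgroup1.
  split=> [x y [Cx Hx] [Cy Hy]|x [Cx Hx]].
    by split; apply: subgroupM.
  by split; apply: subgroupV.
split=> [|x|i lt_in|i lt_in]; first exact: sCH.
- split=> [[]|->]; first exact: CHn.
  by split; apply: subgroup1 => //; apply: series_subgroup.
- have [sHi [HsS nHi]] := nHs lt_in; split; first exact: sCH.
  split=> [x [Cx Hx]|x h [Cx Hx] [Ch Hh]]; first by split=> //; apply: HsS.
  by split; [apply: nC => //; apply: CH | apply: nHi].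
- have [I [S [f fP]]] := qHs _ lt_in.
  have [sHi [HsS nHi]] := nHs lt_in; have sHi' := series_subgroup (ltnW lt_in).
  have nCH : is_normal_in G (fun x => C x /\ Hs i x) (Hs i).
    split; first exact/sCH/ltnW.
    split=> [x []//|x h [Cx Hx] Hh]; split.
      by apply: nC => //; apply: series_sub (ltnW lt_in) Hh.
    by apply: subgroupM (subgroupV _ _) (subgroupM _ _ _).
  have := sum_quotient_normal sHi' fP nCH.
  congr sum_quotient; apply: funext => x; apply: propext.
  by split=> [[[Cx _] Hx]|[Cx Hx]] //; split=> //; split=> //; apply: HsS.
Qed.

End Series.

(** * Compactness and the comparison of topologies *)

Lemma open_local O (W : T -> Prop) : is_topology O ->
  (forall x, W x -> exists V, [/\ O V, V x & forall z, V z -> W z]) -> O W.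
Proof.
move=> [_ [_ OU]] Wnbhd.
have := OU (fun V => O V /\ forall z, V z -> W z) (fun V => @proj1 _ _).
congr O; apply: funext => x; apply: propext; split.
  by move=> [V [[_ VW] Vx]]; apply: VW.
by move=> /Wnbhd[V [OV Vx VW]]; exists V.
Qed.

(** Finite subcovers in induction form: what passes to subsets and finite unions and holds locally
    holds globally. *)
Lemma compact_ind O (P : (T -> Prop) -> Prop) : compact_space O ->
    P (fun _ => False) ->
    (forall U V, P U -> P V -> P (fun x => U x \/ V x)) ->
    (forall U V : T -> Prop, (forall x, U x -> V x) -> P V -> P U) ->
    (forall x, exists V, [/\ O V, V x & P V]) ->
  P (fun _ => True).
Proof.
move=> cO P0 PU Pdown Pnbhd.
have [|x|l [lO lT]] := cO (fun V => O V /\ P V); first by move=> V [].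
  by have [V [OV Vx PV]] := Pnbhd x; exists V.
have Pl : P (fun x => exists U, List.In U l /\ U x).
  elim: l lO {lT} => [_|U l IHl lO]; first by apply: Pdown P0 => x [U [[]]].
  have PU' : P U by have [] := lO U (or_introl erefl).
  have {}IHl := IHl (fun V lV => lO V (or_intror lV)).
  apply: Pdown (PU _ _ PU' IHl) => x [V [[<-|lV] Vx]]; first by left.
  by right; exists V.
by apply: Pdown Pl => x _; apply: lT.
Qed.

(** This says that [(x, y)] lies in the closure of the diagonal of [H] for the product of [O] and
    [O']. *)
Definition jointly_adherent (O O' : topology T) (H : T -> Prop) x y :=
  forall U U', O U -> U x -> O' U' -> U' y -> exists z, [/\ H z, U z & U' z].

(** A closed graph theorem: the diagonal is closed and [O] is compact, so the identity is continuous
    from [O'] to [O]. *)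
Lemma compact_finer O O' : is_topology O' -> compact_space O ->
    (forall x y, jointly_adherent O O' (fun _ => True) x y -> x = y) ->
  is_topology O -> forall U, O U -> O' U.
Proof.
move=> tO' cO adh tO U OU; apply: open_local => // x Ux.
have [OT' [OI' _]] := tO'.
(* [V] is good when it meets some [O']-neighbourhood of [x] only inside [U]. Around [x] one takes
   [U] itself; around any other point non-adherence gives an empty intersection. *)
pose P V := exists W, [/\ O' W, W x & forall z, V z -> W z -> U z].
suff [W [OW Wx WU]] : P (fun _ => True).
  by exists W; split=> // z; apply: WU.
apply: (compact_ind cO).
- by exists (fun _ => True).
- move=> V V' [W [OW Wx WU]] [W' [OW' Wx' WU']].
  exists (fun z => W z /\ W' z); split=> //; first exact: OI'.
  by move=> z [Vz|Vz] [Wz Wz']; [apply: WU | apply: WU'].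
- by move=> V V' VV' [W [OW Wx WU]]; exists W; split=> // z /VV'; apply: WU.
- move=> y; have [->|yx] := pselect (y = x).
    by exists U; split=> //; exists (fun _ => True).
  apply: contrapT => nV; apply: yx; apply: adh => V W OV Vy OW Wx.
  apply: contrapT => VW; apply: nV; exists V; split=> //; exists W; split=> //.
  by move=> z Vz Wz; case: VW; exists z.
Qed.

(** * Topological groups *)

Section TopologicalGroup.
Variable O : topology T.
Hypothesis tG : is_topological_group G O.

Let tO : is_topology O. Proof. by case: tG => _ []. Qed.

Lemma openT : O (fun _ => True). Proof. by case: tO. Qed.

Lemma openI U V : O U -> O V -> O (fun x => U x /\ V x).
Proof. by case: tO => _ [+ _]; apply. Qed.

Lemma openV U : O U -> O (fun x => U (inv x)).
Proof. by case: tG => _ [_ [_]]; apply. Qed.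

Lemma open_mul x y W : O W -> W (x ** y) -> exists U V,
  [/\ O U, O V, U x, V y & forall u v, U u -> V v -> W (u ** v)].
Proof.
move=> OW Wxy; case: tG => _ [_ [+ _]] => /(_ x y W OW Wxy).
by move=> [U [V [? [? [? [? ?]]]]]]; exists U, V.
Qed.

Lemma open_mull a U : O U -> O (fun x => U (a ** x)).
Proof.
move=> OU; apply: open_local => // x Uax.
have [V [W [OV OW Va Wx VWU]]] := open_mul OU Uax.
by exists W; split=> // z; apply: VWU.
Qed.

Lemma open_mulr a U : O U -> O (fun x => U (x ** a)).
Proof.
move=> OU; apply: open_local => // x Uxa.
have [V [W [OV OW Vx Wa VWU]]] := open_mul OU Uxa.
by exists V; split=> // z Vz; apply: VWU.
Qed.

Lemma nbhd1_sqr W : O W -> W e -> exists V,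
  [/\ O V, V e, forall x, V x -> V (inv x) &
      forall x y, V x -> V y -> W (x ** y)].
Proof.
move=> OW We; rewrite -(law_mul1 e) in We.
have [U [V [OU OV Ue Ve UVW]]] := open_mul OW We.
have OUV := openI OU OV.
exists (fun x => (U x /\ V x) /\ (U (inv x) /\ V (inv x))); split.
- by apply: openI => //; apply: openV OUV.
- by rewrite law_inv1.
- by move=> x; rewrite law_invK => -[].
- by move=> x y [[? _] _] [[_ ?] _]; apply: UVW.
Qed.

Lemma open_subgroup K V : is_subgroup G K -> O V -> V e ->
  (forall x, V x -> K x) -> O K.
Proof.
move=> sK OV Ve VK; apply: open_local => // x Kx.
exists (fun z => V (inv x ** z)); split; first exact: open_mull.
  by rewrite law_mulV.
by move=> z /VK Kz; rewrite -(law_mulKV x z); apply: subgroupM.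
Qed.

(** * Open subgroups of compact groups *)

Hypothesis cO : compact_space O.

(** This intersection is shown to be connected, hence trivial in a totally disconnected group. *)
Definition open_subgroup_meet x :=
  forall K, O K -> is_subgroup G K -> K x.
Local Notation Q := open_subgroup_meet.

(** An open subgroup missing [x] is disjoint from its coset through [x]; these cosets cover the
    complement of [Q] in the compactness arguments below. *)
Lemma open_subgroup_meetN x : ~ Q x ->
  exists K, [/\ O K, is_subgroup G K & forall z, K (inv x ** z) -> ~ K z].
Proof.
move=> nQx; apply: contrapT => nK; apply: nQx => K OK sK.
apply: contrapT => nKx; apply: nK; exists K; split=> // z Kxz Kz.
apply: nKx; apply: subgroupVr => //.
have -> : inv x = inv x ** z ** inv z by rewrite !lawE.
by apply: subgroupM => //; apply: subgroupV.
Qed.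

(** The space is covered by translates of [W] by points of [Q] and by cosets disjoint from open
    subgroups; a finite intersection of these subgroups lies in the product [QW]. *)
Lemma open_subgroup_meet_sub W : O W -> W e -> exists K,
  [/\ O K, is_subgroup G K &
      forall z, K z -> exists2 q, Q q & W (inv q ** z)].
Proof.
move=> OW We.
pose P V := exists K, [/\ O K, is_subgroup G K &
  forall z, V z -> K z -> exists2 q, Q q & W (inv q ** z)].
suff [K [OK sK KP]] : P (fun _ => True).
  by exists K; split=> // z; apply: KP.
apply: (compact_ind cO).
- by exists (fun _ => True); split=> //; exact: openT.
- move=> V V' [K [OK sK KP]] [K' [OK' sK' KP']].
  exists (fun z => K z /\ K' z); split; first exact: openI.
    split; first by split; apply: subgroup1.
    split=> [x y [? ?] [? ?]|x [? ?]]; split; try exact: subgroupM.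
      exact: subgroupV.
    exact: subgroupV.
  by move=> z [Vz|Vz] [Kz Kz']; [apply: KP | apply: KP'].
- by move=> V V' VV' [K [OK sK KP]]; exists K; split=> // z /VV'; apply: KP.
- move=> q; have [Qq|/open_subgroup_meetN[K [OK sK nK]]] := pselect (Q q).
    exists (fun z => W (inv q ** z)); split; first exact: open_mull.
      by rewrite law_mulV.
    by exists (fun _ => True); split=> //; [exact: openT | move=> z; exists q].
  exists (fun z => K (inv q ** z)); split; first exact: open_mull.
    by rewrite law_mulV; apply: subgroup1.
  by exists K; split=> // z /nK.
Qed.

(** Continuity of the product at [(q, 1)] gives such a [W] near each [q] in [Q] and [U]; compactness
    makes it uniform. *)
Lemma open_subgroup_meet_separated U V : O U -> O V ->
    (forall x, Q x -> U x \/ V x) -> (forall x, Q x -> U x -> V x -> False) ->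
  exists W, [/\ O W, W e &
    forall a w, Q a -> U a -> W w -> Q (a ** w) -> V (a ** w) -> False].
Proof.
move=> OU OV QUV dUV.
pose P N := exists W, [/\ O W, W e & forall a w, N a ->
  Q a -> U a -> W w -> Q (a ** w) -> V (a ** w) -> False].
suff [W [OW We WP]] : P (fun _ => True).
  by exists W; split=> // a w; apply: WP.
apply: (compact_ind cO).
- by exists (fun _ => True); split=> //; exact: openT.
- move=> N N' [W [OW We WP]] [W' [OW' We' WP']].
  exists (fun z => W z /\ W' z); split=> //; first exact: openI.
  by move=> a w [Na|Na] ? ? [? ?]; [apply: WP | apply: WP'].
- by move=> N N' NN' [W [OW We WP]]; exists W; split=> // a w /NN'; apply: WP.
- move=> q; have [Qq|/open_subgroup_meetN[K [OK sK nK]]] := pselect (Q q).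
    have [Uq|Vq] := QUV _ Qq; last first.
      exists V; split=> //; exists (fun _ => True); split=> //; first exact: openT.
      by move=> a w Va Qa Ua; case: (dUV a).
    rewrite -(law_mulr1 q) in Uq.
    have [N [W [ON OW Nq We NWU]]] := open_mul OU Uq.
    exists N; split=> //; exists W; split=> // a w Na Qa Ua Ww Qaw.
    by apply: dUV => //; apply: NWU.
  exists (fun z => K (inv q ** z)); split; first exact: open_mull.
    by rewrite law_mulV; apply: subgroup1.
  exists (fun _ => True); split=> //; first exact: openT.
  by move=> a w /nK nKa Qa; case: nKa; apply: Qa.
Qed.

(** A chain argument: [A] thickens the part of [Q] in [U] by a small [W]. Small steps inside [K]
    never leave [A], and they generate enough to reach every point of [Q], which contradicts the
    separation of [U] from [V]. *)
Lemma open_subgroup_meet_connected1 U V : O U -> O V ->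
    (forall x, Q x -> U x \/ V x) -> (forall x, Q x -> U x -> V x -> False) ->
  U e -> forall x, Q x -> ~ V x.
Proof.
move=> OU OV QUV dUV Ue b Qb Vb.
have [W0 [OW0 W0e W0P]] := open_subgroup_meet_separated OU OV QUV dUV.
(* Halving twice ensures that a product of three elements of [W] lies in [W0]. *)
have [W1 [OW1 W1e W1V W1P]] := nbhd1_sqr OW0 W0e.
have [W [OW We WV WP]] := nbhd1_sqr OW1 W1e.
have [K [OK sK KP]] := open_subgroup_meet_sub OW We.
have Qe : Q e by move=> L _; apply: subgroup1.
pose A x := exists a, [/\ Q a, U a & W (inv a ** x)].
have Astep x w : K x -> K w -> W w -> A x -> A (x ** w).
  move=> Kx Kw Ww [a [Qa Ua Wax]].
  have [q Qq Wq] := KP _ (subgroupM sK Kx Kw).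
  have [Uq|Vq] := QUV _ Qq; first by exists q.
  (* With [q] in [V], this factorisation leads from [a] in [U] to [q] by an element of [W0], which
     is excluded. *)
  have qE : q = a ** ((inv a ** x ** w) ** inv (inv q ** (x ** w))).
    by rewrite !lawE.
  case: (W0P a (inv a ** x ** w ** inv (inv q ** (x ** w)))) => //.
  - apply: W1P; first exact: WP.
    by rewrite -[X in W1 X]law_mul1; apply: WP => //; apply: WV.
  - by rewrite -qE.
  - by rewrite -qE.
(* Right translations by S preserve closeness to the part of Q inside U, and S
   is an open subgroup, hence contains Q. *)
pose S x := K x /\
  forall y, K y -> A y -> A (y ** x) /\ A (y ** inv x).
have sS : is_subgroup G S.
  split; first by split=> [|y]; [exact: subgroup1 | rewrite law_inv1 law_mulr1].
  split=> [x x' [Kx Sx] [Kx' Sx']|x [Kx Sx]].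
    split=> [|y Ky Ay]; first exact: subgroupM.
    have [Ayx _] := Sx y Ky Ay; have [_ Ayx'] := Sx' y Ky Ay.
    rewrite law_invM -!(law_mulA y); split.
      by have [] := Sx' _ (subgroupM sK Ky Kx) Ayx.
    by have [] := Sx _ (subgroupM sK Ky (subgroupV sK Kx')) Ayx'.
  split=> [|y Ky Ay]; first exact: subgroupV.
  by rewrite law_invK; have [] := Sx y Ky Ay.
have OS : O S.
  apply: (open_subgroup sS (openI OK OW)) => [|x [Kx Wx]].
    by split=> //; apply: subgroup1.
  split=> // y Ky Ay; split; apply: Astep => //; first exact: subgroupV.
  exact: WV.
have [_ /(_ e)] := Qb S OS sS.
have Ae : A e by exists e; split=> //; rewrite law_mulV.
rewrite law_mul1 => /(_ (subgroup1 sK) Ae)[[a [Qa Ua Wab]] _].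
apply: (W0P a (inv a ** b)) => //; rewrite ?law_mulKV //.
rewrite -[X in W0 X]law_mul1; apply: W1P => //.
by rewrite -[X in W1 X]law_mul1; apply: WP.
Qed.

Lemma open_subgroup_meet_connected : connected_subset O Q.
Proof.
move=> [U [V [OU [OV [QUV [[x [Qx Ux]] [[y [Qy Vy]] dUV]]]]]]].
have Qe : Q e by move=> L _; apply: subgroup1.
have [Ue|Ve] := QUV e Qe.
  exact: open_subgroup_meet_connected1 OU OV QUV dUV Ue y Qy Vy.
apply: open_subgroup_meet_connected1 OV OU _ _ Ve x Qx Ux => z Qz.
  by have [] := QUV z Qz; [right | left].
by move=> Vz Uz; apply: dUV Qz Uz Vz.
Qed.

(** The core [U] is the intersection of all conjugates of [H]. A conjugate depends only on a coset
    of [H], so compactness gives one neighbourhood of 1 inside all of them. *)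
Lemma open_normal_core H : O H -> is_subgroup G H ->
  exists U, [/\ O U, is_normal_in G U (fun _ => True) & forall x, U x -> H x].
Proof.
move=> OH sH; pose U x := forall g, H (inv g ** (x ** g)).
have sU : is_subgroup G U.
  split=> [g|]; first by rewrite !lawE; apply: subgroup1.
  split=> [x y Ux Uy g|x Ux g].
    have -> : inv g ** (x ** y ** g)
            = inv g ** (x ** g) ** (inv g ** (y ** g)) by rewrite !lawE.
    exact: subgroupM.
  have -> : inv g ** (inv x ** g) = inv (inv g ** (x ** g)) by rewrite !lawE.
  exact: subgroupV.
exists U; split.
- pose P N := exists V, [/\ O V, V e &
    forall g x, N g -> V x -> H (inv g ** (x ** g))].
  suff [V [OV Ve VP]] : P (fun _ => True).
    by apply: (open_subgroup sU OV Ve) => x Vx g; apply: VP.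
  apply: (compact_ind cO).
  + by exists (fun _ => True); split=> //; exact: openT.
  + move=> N N' [W [OW We WP]] [W' [OW' We' WP']].
    exists (fun z => W z /\ W' z); split=> //; first exact: openI.
    by move=> g x [Ng|Ng] [Wx Wx']; [apply: WP | apply: WP'].
  + by move=> N N' NN' [W [OW We WP]]; exists W; split=> // g x /NN'; apply: WP.
  + move=> q; exists (fun g => H (inv q ** g)); split; first exact: open_mull.
      by rewrite law_mulV; apply: subgroup1.
    exists (fun x => H (inv q ** (x ** q))); split.
    * exact: (open_mulr q (open_mull (inv q) OH)).
    * by rewrite !lawE; apply: subgroup1.
    * move=> g x Hg Hx.
      have -> : inv g ** (x ** g)
          = inv (inv q ** g) ** (inv q ** (x ** q) ** (inv q ** g)).
        by rewrite !lawE.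
      by apply: subgroupM (subgroupV _ _) (subgroupM _ _ _).
- split=> //; split=> // x h Ux _ g.
  by have := Ux (h ** g); rewrite !lawE.
- by move=> x /(_ e); rewrite !lawE.
Qed.

Lemma open_normal_separates x : totally_disconnected O -> x <> e ->
  exists U, [/\ O U, is_normal_in G U (fun _ => True) & ~ U x].
Proof.
move=> tdO xe.
have Qe : Q e by move=> L _; apply: subgroup1.
have [K [OK sK nKx]] : exists K, [/\ O K, is_subgroup G K & ~ K x].
  apply: contrapT => nK; apply: xe.
  apply: tdO open_subgroup_meet_connected _ _ _ Qe => K OK sK.
  by apply: contrapT => nKx; apply: nK; exists K.
have [U [OU nU UK]] := open_normal_core OK sK.
by exists U; split=> // /UK.
Qed.

End TopologicalGroup.

(** The form in which compactness and total disconnectedness enter the induction on the series. *)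
Definition separated_by_normal (O : topology T) := forall x, x <> e ->
  exists U, [/\ O U, is_normal_in G U (fun _ => True) & ~ U x].

(** * The simple factors of the last nontrivial term and their centraliser *)

Section Factors.
Variables (n : nat) (Hs : nat -> T -> Prop).
Variables (I : Type) (S : I -> finGroupType) (f : T -> forall i, S i).
Hypotheses (sHs0 : is_subgroup G (Hs 0))
  (nHs : forall i, i < n -> is_normal_in G (Hs i.+1) (Hs i))
  (fP : sum_quotient_map (Hs n) (fun x => x = e) f).

Let sHn : is_subgroup G (Hs n). Proof. exact: (series_subgroup sHs0 nHs). Qed.

Local Notation F := (factor (Hs n) f).

(** An open normal [U] avoiding one nontrivial element of the factor meets it trivially, so
    [subnormal_commute] applies. *)
Lemma factor_centralised_by_open O i : separated_by_normal O ->
  exists U, [/\ O U, is_normal_in G U (fun _ => True) &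
    forall u x, Hs 0 u -> U u -> F i x -> law_commute u x].
Proof.
move=> sepO; case: (fP) => simS _ fsurj _; have [simSi _] := simS i.
have /trivgPn[s _ s1] : [set: S i] != 1%g by case/simpleP: simSi.
have [y [Hy fyi fy]] := fsurj i s.
have ye : y <> e.
  by move=> E; case/eqP: s1; rewrite -fyi E (sum_quotient_map1 sHn fP).
have [U [OU nU nUy]] := sepO y ye; exists U; split=> //.
move=> u x; apply: (subnormal_commute sHs0 nHs _ _ _ _ nU).
- by move=> z [].
- exact: (factor_perfect sHn fP).
- exact: (factor_subgroup sHn fP).
- by move=> z h; apply: (factor_conj sHn fP).
- move=> z Fz Uz; apply: (factor_meet_normal sHn fP _ nU _ Fz Uz) => //.
  by exists y.
Qed.

(** Conjugates are included because a factor is only known to be normal in [Hs n], while the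
    centraliser has to be normal in [Hs 0]. *)
Definition factor_centraliser x :=
  Hs 0 x /\ forall h i y, Hs 0 h -> F i y -> law_commute x (inv h ** y ** h).
Local Notation C := factor_centraliser.

Lemma factor_centraliser_normal : is_normal_in G C (Hs 0).
Proof.
split; last split; [split; last split| |].
- split=> [|h i y _ _]; first exact: subgroup1.
  by rewrite /law_commute !lawE.
- move=> x y [Hx Cx] [Hy Cy]; split=> [|h i z Hh Fz]; first exact: subgroupM.
  by apply: law_commuteM; [apply: Cx Fz | apply: Cy Fz].
- move=> x [Hx Cx]; split=> [|h i z Hh Fz]; first exact: subgroupV.
  by apply: law_commuteV; apply: Cx Fz.
- by move=> x [].
- move=> x h [Hx Cx] Hh; have HVh := subgroupV sHs0 Hh.
  split=> [|k i y Hk Fy]; first by do 2?apply: subgroupM.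
  have E := Cx (k ** inv h) i y (subgroupM sHs0 Hk HVh) Fy.
  have -> : inv k ** y ** k
      = inv h ** (inv (k ** inv h) ** y ** (k ** inv h)) ** h by rewrite !lawE.
  by apply: law_commuteJ; rewrite law_mulKV law_mulA law_mulrV law_mulr1.
Qed.

Lemma factor_centraliser_meet x : C x -> Hs n x -> x = e.
Proof.
move=> [_ Cx] Hx; apply: (sum_quotient_centre fP) => // i y Hy fy.
have := Cx e i y (subgroup1 sHs0) (conj Hy fy).
by rewrite law_inv1 law_mul1 law_mulr1.
Qed.

(** Open normal subgroups [U] and [U'] for the two topologies centralise the factor. Adherence gives
    [x] in [U'] with [inv g ** x] in [U], so [g] is a product of elements centralising the
    conjugates of the factor. *)
Lemma adherent_factor_centraliser O O' g :
    is_topological_group G O ->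
    separated_by_normal O -> separated_by_normal O' ->
  Hs 0 g -> jointly_adherent O O' (Hs 0) g e -> C g.
Proof.
move=> tO sepO sepO' Hg adh; split=> // h i y Hh Fy.
have [U [OU [sU [_ nU]] cU]] := factor_centralised_by_open i sepO.
have [U' [OU' [sU' [_ nU']] cU']] := factor_centralised_by_open i sepO'.
have cJ V v : is_subgroup G V ->
    (forall x h, V x -> True -> V (inv h ** (x ** h))) ->
    (forall u x, Hs 0 u -> V u -> F i x -> law_commute u x) ->
    Hs 0 v -> V v -> law_commute v (inv h ** y ** h).
  move=> sV nV cV Hv Vv; apply: law_commuteJ; apply: cV => //.
    by do 2?apply: subgroupM => //; apply: subgroupV.
  by have := nV v (inv h) Vv Logic.I; rewrite !lawE.
have [|||x [Hx Ux U'x]] := adh (fun z => U (inv g ** z)) U' _ _ OU'.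
- exact: (open_mull tO).
- by rewrite law_mulV; apply: subgroup1.
- exact: subgroup1.
have -> : g = x ** inv (inv g ** x) by rewrite !lawE.
apply: law_commuteM; first exact: (cJ U').
apply: law_commuteV; apply: (cJ U) => //.
by apply: subgroupM => //; apply: subgroupV.
Qed.

End Factors.

(** * Induction on the length of the series *)

Lemma commutator_nbhd O x g W : is_topological_group G O ->
    O W -> W (law_commutator x g) ->
  exists U, [/\ O U, U g & forall u, U u -> W (law_commutator x u)].
Proof.
move=> tO OW /(open_mul tO (open_mull tO (inv x) OW)).
move=> [U [V [OU OV Ug Vg UVW]]].
exists (fun u => U (inv u) /\ V (x ** u)); split=> //.
  by apply: (openI tO); [apply: (openV tO) | apply: (open_mull tO)].
by move=> u [Uu Vu]; apply: UVW.
Qed.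

Lemma series_adherent O O' : is_topological_group G O ->
    is_topological_group G O' ->
    separated_by_normal O -> separated_by_normal O' ->
  forall n Hs, sum_series n Hs ->
  forall g, Hs 0 g -> jointly_adherent O O' (Hs 0) g e -> g = e.
Proof.
move=> tO tO' sepO sepO'; elim=> [|n IHn] Hs [sHs0 Hsn nHs qHs] g Hg adh.
  exact/Hsn.
have [I [S [f fP]]] := qHs n (ltnSn n).
rewrite (_ : Hs n.+1 = (fun x => x = e)) in fP; last first.
  by apply: funext => x; apply/propext/Hsn.
have nHs' i : i < n -> is_normal_in G (Hs i.+1) (Hs i).
  by move=> lt_in; apply/nHs/ltnW.
have qHs' i : i < n -> sum_quotient (Hs i) (Hs i.+1).
  by move=> lt_in; apply/qHs/ltnW.
pose C := factor_centraliser n Hs f.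
have nC : is_normal_in G C (Hs 0) by apply: factor_centraliser_normal.
have [sC [CH nCH]] := nC.
have Cg : C g by apply: adherent_factor_centraliser tO sepO sepO' Hg adh.
have CHn := factor_centraliser_meet sHs0 fP.
have serC := series_normal sHs0 nHs' nC qHs' CHn.
have [sC0 C1 nC' qC] := serC.
(* It suffices that [g] is central in [C]. Each [[x, g]] is killed by the induction hypothesis, as
   the series of [C] has length [n]. *)
apply: (series_centre nC' C1 qC) => //= x [Cx Hx].
apply/law_commute_sym/law_commuteP; apply: (IHn _ serC) => /=.
  have Cxg : C (law_commutator x g).
    by apply: subgroupM (nCH _ _ Cx Hg) => //; apply: subgroupV.
  by split=> //; apply: CH.
move=> V V' OV Vg OV' V'e.
have [U [OU Ug UV]] := commutator_nbhd tO OV Vg.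
(* As [[x, 1] = 1], a single [z] close to [g] for [O] and to 1 for [O'] gives [[x, z]] close to
   [[x, g]] and to 1; normality keeps it in [C]. *)
have V'x : V' (law_commutator x e) by rewrite /law_commutator !lawE.
have [U' [OU' U'e UV']] := commutator_nbhd tO' OV' V'x.
have [z [Hz Uz U'z]] := adh U U' OU Ug OU' U'e.
exists (law_commutator x z); split; [|exact: UV|exact: UV'].
have Cxz : C (law_commutator x z).
  by apply: subgroupM (nCH _ _ Cx Hz) => //; apply: subgroupV.
by split=> //; apply: CH.
Qed.

End GroupLaws.

Theorem mainTheorem12 (T : Type) (G : group_law T) (O : topology T) :
  profinite G O -> finite_semisimple_length G O -> profinitely_rigid G.
Proof.
move=> pO [n [Hs [Hs0 [Hsn [clHs qHs]]]]]; exists O; split=> // O' pO'.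
have [tG [cO [_ tdO]]] := pO; have [tG' [cO' [_ tdO']]] := pO'.
have [isG [tO _]] := tG; have [_ [tO' _]] := tG'.
have ser : sum_series G n Hs.
  split; [by case: (clHs 0 (leq0n n)) | exact: Hsn | |] => i lt_in.
    by case: (qHs i lt_in).
  by have [_ /sum_quotient_of_semisimple] := qHs i lt_in.
have sepO : separated_by_normal G O.
  by move=> x; apply: open_normal_separates.
have sepO' : separated_by_normal G O'.
  by move=> x; apply: open_normal_separates.
have adh1 := series_adherent isG tG tG' sepO sepO' ser (Hs0 _).
(* Left translation by the inverse of [y] turns an adherent pair [(x, y)] into one with second entry
   1. *)
have adh x y : jointly_adherent O O' (fun _ => True) x y -> x = y.
  move=> xy; apply: esym; apply: (law_mulVeq1 isG); apply: adh1.
  move=> U U' OU Ux OU' U'e.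
  have [|||z [_ Uz U'z]] := xy (fun z => U (gmul G (ginv G y) z))
      (fun z => U' (gmul G (ginv G y) z)) _ Ux _ _.
  - exact: (open_mull tG).
  - exact: (open_mull tG').
  - by rewrite law_mulV.
  by exists (gmul G (ginv G y) z).
(* The closed graph argument gives both inclusions, since adherence is symmetric when points and
   topologies are swapped together. *)
apply: funext => U; apply: propext; split; last exact: compact_finer adh tO U.
apply: compact_finer => // x y yx; apply/esym/adh => V W OV Vx OW Wy.
by have [z [? ? ?]] := yx W V OW Wy OV Vx; exists z.
Qed.
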